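(* Let $N\ge1$ and consider the $1$-parameter family $\mathcal{X}_t:=\{f_t(\mathbf{x})=0\}$, $t\in\mathbb{C}$, with $$f_0(\mathbf{x}):=\sum_{i=1}^{N-1}x_i^2+x_N^3+x_Nx_{N+1}^3,$$ $$f_t(\mathbf{x}):=f_0(\mathbf{x})+432t^3(x_N+4t\,x_{N+1})^2-120t^2x_Nx_{N+1}^2-416t^3x_{N+1}^3+7t\,x_{N+1}^4 .$$ Then $\mathcal{X}_0$ has an isolated $E_7$ singular point (at the origin) and, for generic $t\in\mathbb{C}$, $\mathcal{X}_t$ admits the unique singular point $\mathbf{0}\in f_t^{-1}(0)$, which is of type $A_6$.
   Context: $\mathbf{x}=(x_1,\ldots,x_{N+1})\in\mathbb{C}^{N+1}$. An isolated hypersurface singularity is of type $A_m$ (resp. $E_7$) if it is equivalent, up to a local biholomorphic change of coordinates, to $\sum_{i=1}^Nx_i^2+x_{N+1}^{m+1}=0$ (resp. $\sum_{i=1}^{N-1}x_i^2+x_N^3+x_Nx_{N+1}^3=0$) at the origin. *)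

(* Defs.v *)
From HB Require Import structures.
From mathcomp Require Import all_boot all_order all_algebra.
From mathcomp Require Import complex.
From mathcomp Require Import boolp classical_sets functions cardinality reals.
From mathcomp Require Import topology normedtype derive.

Set Implicit Arguments.
Unset Strict Implicit.
Unset Printing Implicit Defensive.

Import Order.TTheory GRing.Theory Num.Theory numFieldNormedType.Exports.
Local Open Scope classical_set_scope.
Local Open Scope ring_scope.

(* The complex numbers.  With this packaging, [CC R] and ['rV[CC R]_n.+1] carry
   the norm topology and are normed modules over [CC R], so that
   [differentiable] means complex (Frechet) differentiable. *)
Definition CC (R : realType) : numClosedFieldType := R[i].

Section Singularities.
Context {R : realType} {n : nat}.
Local Notation C := (CC R).
Local Notation Cn := 'rV[C]_n.+1.
Implicit Types (f g : Cn -> C) (p q : Cn).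

(* Meant for open [U]: complex differentiable at every point of [U]. *)
Definition holomorphic_on {W : normedModType C} (U : set Cn) (f : Cn -> W) :=
  forall x, U x -> differentiable f x.

Definition biholomorphism (U V : set Cn) (phi psi : Cn -> Cn) : Prop :=
  [/\ open U, open V, holomorphic_on U phi & holomorphic_on V psi] /\
  [/\ (forall x, U x -> V (phi x)), (forall y, V y -> U (psi y)),
      (forall x, U x -> psi (phi x) = x) & (forall y, V y -> phi (psi y) = y)].

(* The hypersurface germs ({f = 0}, p) and ({g = 0}, q) correspond under a local
   biholomorphic change of coordinates [phi]: the equations [f] and
   [g \o phi] generate the same ideal at [p], i.e. they differ by a
   nowhere vanishing holomorphic factor [u]. *)
Definition equivalent_germs f p g q : Prop :=
  exists (U V : set Cn) (phi psi : Cn -> Cn) (u : Cn -> C),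
    [/\ biholomorphism U V phi psi, U p & phi p = q] /\
    [/\ holomorphic_on U u, (forall x, U x -> u x != 0) &
        (forall x, U x -> f x = u x * g (phi x))].

(* The singular points of the hypersurface {f = 0}: f(p) = 0 and df_p = 0. *)
Definition singular_points f : set Cn := [set p | f p = 0 /\ is_diff p f 0].

Definition isolated_singularity f p : Prop := isolated (singular_points f) p.

End Singularities.

Section Family.
Context {R : realType}.
Variable N : nat.
Local Notation C := (CC R).
Local Notation CN1 := 'rV[C]_N.+1.
Implicit Types (x p : CN1) (f : CN1 -> C).

(* Coordinates numbered from 1: x = (x_1, ..., x_{N+1}); [i] ranges over
   1, ..., N.+1. *)
Definition crd x (i : nat) : C := x 0 (inord i.-1).

Definition A_form (m : nat) x : C :=
  \sum_(1 <= i < N.+1) crd x i ^+ 2 + crd x N.+1 ^+ m.+1.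

Definition E7_form x : C :=
  \sum_(1 <= i < N) crd x i ^+ 2 + crd x N ^+ 3 + crd x N * crd x N.+1 ^+ 3.

Definition type_A (m : nat) f p : Prop :=
  isolated_singularity f p /\ equivalent_germs f p (A_form m) 0.

Definition type_E7 f p : Prop :=
  isolated_singularity f p /\ equivalent_germs f p E7_form 0.

Definition f_ (t : C) x : C :=
  E7_form x
  + 432 * t ^+ 3 * (crd x N + 4 * t * crd x N.+1) ^+ 2
  - 120 * t ^+ 2 * crd x N * crd x N.+1 ^+ 2
  - 416 * t ^+ 3 * crd x N.+1 ^+ 3
  + 7 * t * crd x N.+1 ^+ 4.

End Family.

(* Outside a proper Zariski closed subset of the affine line over [CC R], i.e.
   outside a finite set. *)
Definition generic {R : realType} (P : CC R -> Prop) : Prop :=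
  finite_set [set t | ~ P t].

(* Main.v *)
Require Import Defs.
From HB Require Import structures.
From mathcomp Require Import all_boot all_order all_algebra.
From mathcomp Require Import complex.
From mathcomp Require Import boolp classical_sets functions cardinality reals.
From mathcomp Require Import topology normedtype derive.
From mathcomp Require Import ring zify.

(** The first [N - 1] variables enter only through their squares, so everything
    happens in the plane curve [g_t(a, b) = 0] of the last two. The family is
    weighted homogeneous, with [t] of weight 1: for [t] nonzero the substitution
    [a = t ^ 3 y], [b = t ^ 2 z] reduces [g_t] to [t ^ 9 g], where [g = g_1]
    (plane_family_scale).

    Put [w = y + 4 z] and [v = 12 w - z ^ 2]. Then
    [12 g = (6 v - w z) ^ 2 + v w ^ 2]. This identity exhibits [g = 0] as a rational
    quartic whose only singular point is the origin (plane_family_singular), with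
    parametrization [z = - s ^ 2 (s + 6) / (s + 3)],
    [v = - s ^ 6 / (s + 3) ^ 2].

    For fixed [z] the equation is a cubic in [v]. Its roots correspond to the three
    values of [s] over [z]; near [z = 0] two of them are close to [s = 0] and one
    is close to [s = -6]. The far one, [tau = s + 6], can replace [z] as a local
    coordinate. Then [g] factors rationally in [v] and [tau]: the linear factor of
    the far root is a unit, and the quadratic factor of the two small roots, after
    completing the square, is a unit times [X ^ 2 + Z ^ 7] with [X] and [Z] rational
    in [v] and [tau] (plane_family_factor). Dividing the other variables by a square
    root of the total unit gives the normal form [A_6].

    It remains to invert the coordinate changes holomorphically. They are triangular,
    so only functions of one variable have to be inverted, and these are rational.
    Their inverses, and the square root, come from a single statement
    (rational_inverse): a small root exists because the complex numbers are
    algebraically closed, and divided differences show that it is holomorphic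
    (inverse_holo). For [t = 0] the polynomial is the normal form [E_7] itself, so
    the only exceptional parameter is [0]. *)

Set Implicit Arguments.
Unset Strict Implicit.
Unset Printing Implicit Defensive.

Import Order.TTheory GRing.Theory Num.Theory numFieldNormedType.Exports.
Local Open Scope classical_set_scope.
Local Open Scope ring_scope.

(** * Germs of holomorphic functions *)

Lemma near_everywhere (U : topologicalType) (p : U) (P : U -> Prop) :
  (forall x, P x) -> \forall x \near p, P x.
Proof. by move=> HP; exact: nearW. Qed.

Lemma continuous_cvg_to (U W : topologicalType) (f : U -> W) (a : U) (b : W) :
  {for a, continuous f} -> f a = b -> f x @[x --> a] --> b.
Proof. by move=> + <-. Qed.

Lemma near_comp (U W : topologicalType) (f : U -> W) (a : U) (b : W) (P : W -> Prop) :
    {for a, continuous f} -> f a = b -> (\forall y \near b, P y) ->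
  \forall x \near a, P (f x).
Proof. by move=> fc fa Pb; have /(_ _ Pb) := continuous_cvg_to fc fa. Qed.

Section Holo.
Context {K : numFieldType} {V : normedModType K}.
Implicit Types (f g : V -> K) (p : V).

(** Differentiability on a whole neighbourhood, so that the notion passes to
    products, quotients and composites of germs. *)
Definition holo_at {W W' : normedModType K} (f : W -> W') (p : W) : Prop :=
  \forall x \near p, differentiable f x.

Lemma holo_cont {W W' : normedModType K} (f : W -> W') (p : W) :
  holo_at f p -> {for p, continuous f}.
Proof. by move=> /nbhs_singleton; exact: differentiable_continuous. Qed.

Lemma holo_cst {W W' : normedModType K} (c : W') (p : W) : holo_at (fun=> c) p.
Proof. by apply: nearW => x; exact: differentiable_cst. Qed.

Lemma holo_id {W : normedModType K} (p : W) : holo_at (fun x => x) p.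
Proof. by apply: nearW => x; case: (is_diff_id x). Qed.

Lemma holoD {W : normedModType K} (f g : V -> W) p :
  holo_at f p -> holo_at g p -> holo_at (fun x => f x + g x) p.
Proof. by apply: filterS2 => x; exact: differentiableD. Qed.

Lemma holoB {W : normedModType K} (f g : V -> W) p :
  holo_at f p -> holo_at g p -> holo_at (fun x => f x - g x) p.
Proof. by apply: filterS2 => x; exact: differentiableB. Qed.

Lemma holoM f g p :
  holo_at f p -> holo_at g p -> holo_at (fun x => f x * g x) p.
Proof. by apply: filterS2 => x; exact: differentiableM. Qed.

Lemma holoX f n p : holo_at f p -> holo_at (fun x => f x ^+ n) p.
Proof.
move=> hf; elim: n => [|n IHn]; first exact: holo_cst.
have -> : (fun x => f x ^+ n.+1) = (fun x => f x * f x ^+ n).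
  by apply/funext => x; rewrite exprS.
exact: holoM.
Qed.

Lemma near_neq0 f p : {for p, continuous f} -> f p != 0 ->
  \forall x \near p, f x != 0.
Proof.
move=> fc fp0.
have : \forall y \near f p, y != 0.
  apply/nbhs_ballP; exists `|f p|; first by rewrite /= normr_gt0.
  move=> y; rewrite -ball_normE /ball_ /= => fpy.
  by apply: contraTneq fpy => ->; rewrite subr0 ltxx.
exact: fc.
Qed.

Lemma holoV f p : f p != 0 -> holo_at f p -> holo_at (fun x => (f x)^-1) p.
Proof.
move=> fp0 hf; have := near_neq0 (holo_cont hf) fp0; move: hf.
by apply: filterS2 => x df fx0; exact: differentiableV.
Qed.

Lemma holo_comp {W W' : normedModType K} (f : V -> W) (g : W -> W') p :
  holo_at f p -> holo_at g (f p) -> holo_at (fun x => g (f x)) p.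
Proof.
move=> hf hg; have := holo_cont hf hg; move: hf.
by apply: filterS2 => x df dg; exact: differentiable_comp.
Qed.

(** A map into row vectors is the sum of its coordinates times the standard
    basis. *)
Lemma holo_row n (f : 'I_n.+1 -> V -> K) p :
  (forall j, holo_at (f j) p) -> holo_at (fun x => \row_j f j x) p.
Proof.
move=> hf.
have : \forall x \near p, forall j, differentiable (f j) x.
  by apply: filter_forall.
apply: filterS => x df.
have -> : (fun x => \row_j f j x) =
   \sum_(j < n.+1) (fun x => f j x *: (delta_mx 0 j : 'rV[K]_n.+1)).
  apply/funext => y; rewrite fct_sumE [LHS]row_sum_delta.
  by apply: eq_bigr => j _; rewrite mxE.
by apply: differentiable_sum => j; exact: differentiableZl.
Qed.

End Holo.

Lemma holo_everywhere (K : numFieldType) (W W' : normedModType K) (f : W -> W')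
  (p : W) : (forall x, differentiable f x) -> holo_at f p.
Proof. by move=> df; exact: near_everywhere. Qed.

Lemma holo_coord (K : numFieldType) n (j : 'I_n.+1) (p : 'rV[K]_n.+1) :
  holo_at (fun x : 'rV[K]_n.+1 => x 0 j) p.
Proof. by apply: holo_everywhere => x; exact: differentiable_coord. Qed.

Section Pairs.
Context {K : numFieldType} {V U W : normedModType K}.

Lemma holo_pair (f : V -> U) (g : V -> W) (p : V) :
  holo_at f p -> holo_at g p -> holo_at (fun x => (f x, g x)) p.
Proof. by apply: filterS2 => x df dg; exact: differentiable_pair. Qed.

Lemma holo_fst (p : U * W) : holo_at (fun u : U * W => u.1) p.
Proof.
apply: holo_everywhere => x.
by apply: (@linear_differentiable _ _ _ fst) => y; exact: cvg_fst.
Qed.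

Lemma holo_snd (p : U * W) : holo_at (fun u : U * W => u.2) p.
Proof.
apply: holo_everywhere => x.
by apply: (@linear_differentiable _ _ _ snd) => y; exact: cvg_snd.
Qed.
End Pairs.

(** Matching on the head operation, rather than trying the closure lemmas one
    after the other, keeps unification from unfolding the ring operations. *)
Ltac holo :=
  lazymatch goal with
  | |- holo_at (fun=> ?c) _ => exact: holo_cst
  | |- holo_at (fun x => @?f x + - @?g x) _ => apply: (@holoB _ _ _ f g); holo
  | |- holo_at (fun x => @?f x + @?g x) _ => apply: (@holoD _ _ _ f g); holo
  | |- holo_at (fun x => @?f x * @?g x) _ => apply: (@holoM _ _ f g); holo
  | |- holo_at (fun x => @?f x ^+ _) _ => apply: (@holoX _ _ f); holo
  | |- holo_at (fun x => (@?f x)^-1) _ => apply: (@holoV _ _ f); [|holo]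
  | |- holo_at (fun x => x) _ => exact: holo_id
  | |- _ => try assumption
  end.

(** * Inverting a rational function of one variable *)

Lemma cvg_pair_nbhs (X : Type) (F : set_system X) {FF : Filter F}
    (U W : topologicalType) (f : X -> U) (g : X -> W) (a : U) (b : W) :
  f x @[x --> F] --> a -> g x @[x --> F] --> b ->
  (f x, g x) @[x --> F] --> (a, b).
Proof. exact: cvg_pair. Qed.

(** The factor [k] is a divided difference of [h]. Applied at two values of [T] it
    gives [y - z = (T y - T z) * k (T y, T z)], so a lower bound on [k] makes [T]
    Lipschitz, hence continuous near [0], and then [1 / k] is the limit of the
    difference quotients of [T]. The same identity makes [h] injective near [0],
    which turns a right inverse into a left one. *)
Lemma inverse_holo (K : numFieldType) (h T : K -> K) (k : K * K -> K) :
    h 0 = 0 -> {for 0, continuous h} -> T 0 = 0 -> {for 0, continuous T} ->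
    k (0, 0) != 0 -> (\forall p \near ((0, 0) : K * K), {for p, continuous k}) ->
    (\forall p \near ((0, 0) : K * K), h p.1 - h p.2 = (p.1 - p.2) * k p) ->
    (\forall y \near (0 : K), h (T y) = y) ->
  holo_at T 0 /\ \forall x \near (0 : K), T (h x) = x.
Proof.
move=> h0 hc T0 Tc k0 kc hk hT.
set c := `|k (0, 0)| / 2.
have c0 : 0 < c by rewrite divr_gt0 ?normr_gt0.
have kb : \forall p \near ((0, 0) : K * K), c < `|k p|.
  have kc0 : k p @[p --> ((0, 0) : K * K)] --> k (0, 0) by exact: nbhs_singleton kc.
  apply: (cvgr_norm_gt _ kc0).
  by rewrite /c ltr_pdivrMr // ltr_pMr ?ltr1n // normr_gt0.
pose good (p : K * K) :=
  [/\ {for p, continuous k}, h p.1 - h p.2 = (p.1 - p.2) * k p & c < `|k p|].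
have gd : \forall p \near ((0, 0) : K * K), good p.
  by move: kc hk kb; apply: filterS3.
split; last first.
  have hTc : {for 0, continuous (T \o h)}.
    by apply: continuous_comp => //; rewrite h0.
  have : \forall x \near (0 : K), good (T (h x), x).
    have /(_ good) : (T (h x), x) @[x --> (0 : K)] --> ((0, 0) : K * K).
      apply: (@cvg_pair_nbhs _ (nbhs (0 : K))); last exact: cvg_id.
      by apply: (@continuous_cvg_to _ _ (T \o h) 0 0 hTc); rewrite /= h0.
    exact.
  have hhT : \forall x \near (0 : K), h (T (h x)) = h x.
    have hc0 : h x @[x --> (0 : K)] --> (0 : K).
      exact: (@continuous_cvg_to _ _ h 0 0 hc h0).
    exact: hc0 hT.
  move: hhT; apply: filterS2 => x /= hhTx [/= _ + kx]; rewrite hhTx subrr.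
  move/esym/eqP; rewrite mulf_eq0 subr_eq0 => /orP[/eqP//|/eqP kx0].
  by move: (lt_trans c0 kx); rewrite kx0 normr0 ltxx.
have gT : \forall p \near ((0, 0) : K * K), good (T p.1, T p.2).
  have /(_ good) : (T p.1, T p.2) @[p --> ((0, 0) : K * K)] --> ((0, 0) : K * K).
    apply: (@cvg_pair_nbhs _ (nbhs ((0, 0) : K * K)));
      apply: (cvg_comp _ _ _ (@continuous_cvg_to _ _ T 0 0 Tc T0)).
      exact: cvg_fst.
    exact: cvg_snd.
  exact.
case: gT => -[A B] /= [A0 B0] AB.
have : \forall y \near (0 : K), \near y, [/\ A y, B y & h (T y) = y].
  by apply: near_join; move: A0 B0 hT; apply: filterS3.
apply: filterS => y ngy.
have [Ay By hTy] := nbhs_singleton ngy.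
have key : \forall z \near y, z - y = (T z - T y) * k (T z, T y) /\ c < `|k (T z, T y)|.
  move: ngy; apply: filterS => z [Az Bz hTz].
  by have [_ /= + ?] := AB (z, y) (conj Az By); rewrite hTz hTy.
have Tcy : {for y, continuous T}.
  apply/(cvgrPdist_lt (F := nbhs y)) => e e0.
  have ec0 : 0 < e * c by rewrite mulr_gt0.
  have : \forall z \near y, `|y - z| < e * c.
    by have := near_ball y _ ec0; rewrite -ball_normE.
  move: key; apply: filterS2 => z [zy kz] yz.
  rewrite -(ltr_pM2r c0); apply: le_lt_trans yz.
  rewrite distrC (distrC y z) zy normrM ler_wpM2l //; exact: ltW.
apply/derivable1_diffP.
have [kcy _ /= cy] := AB (y, y) (conj Ay By).
have ky0 : k (T y, T y) != 0 by rewrite -normr_gt0 (lt_trans c0).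
apply/cvg_ex; exists (k (T y, T y))^-1.
have sh : (s *: 1 + y) @[s --> (0 : K)^'] --> y.
  have : (s *: 1 + y) @[s --> (0 : K)^'] --> 0 *: 1 + y.
    apply: cvgD; last exact: cvg_cst.
    by apply: cvgZ; [exact: nbhs_dnbhs | exact: cvg_cst].
  by rewrite scale0r add0r.
have : (k (T (s *: 1 + y), T y))^-1 @[s --> (0 : K)^'] --> (k (T y, T y))^-1.
  apply: cvgV => //.
  apply: (cvg_comp (fun s : K => (T (s *: 1 + y), T y)) k _ kcy).
  apply: (@cvg_pair_nbhs _ ((0 : K)^')); last exact: cvg_cst.
  by apply: (cvg_comp _ _ sh Tcy).
apply: cvg_trans; apply: near_eq_cvg.
have s0 : \forall s \near (0 : K)^', s != 0 by exact: nbhs_dnbhs_neq.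
have := sh _ key; move: s0; apply: filterS2 => s s0 /= [skey kc'].
have kn0 : k (T (s *: 1 + y), T y) != 0 by rewrite -normr_gt0 (lt_trans c0).
rewrite addrK in skey.
have -> : T (s *: 1 + y) - T y = s / k (T (s *: 1 + y), T y).
  by apply: (mulIf kn0); rewrite -skey divfK //; exact: mulr1.
by rewrite /GRing.scale /= mulrA mulVf // mul1r.
Qed.

Lemma continuous_poly (K : numFieldType) (P : {poly K}) :
  continuous (fun x => P.[x]).
Proof.
elim/poly_ind: P => [|P c IHP] x.
  have -> : (fun x : K => 0.[x]) = (fun=> 0) by apply/funext => y; rewrite horner0.
  exact: cst_continuous.
have -> : (fun x => (P * 'X + c%:P).[x]) = (fun x => P.[x] * x + c).
  by apply/funext => y; rewrite hornerMXaddC.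
apply: (@continuousD _ _ _ (fun x => P.[x] * x)); last exact: cst_continuous.
by apply: (@continuousM _ _ (fun x => P.[x])); [exact: IHP | exact: cvg_id].
Qed.

Lemma poly_divided_difference (K : numFieldType) (P : {poly K}) :
  exists k : K * K -> K, [/\ continuous k, k (0, 0) = P`_1 &
    forall a b, P.[a] - P.[b] = (a - b) * k (a, b)].
Proof.
elim/poly_ind: P => [|P c [k [kc k0 kE]]].
  exists (fun=> 0); split; [exact: cst_continuous | by rewrite coef0 |].
  by move=> a b; rewrite !horner0 subrr mulr0.
exists (fun p => P.[p.1] + p.2 * k p); split => [p||a b].
- apply: (@continuousD _ _ _ (fun p : K * K => P.[p.1])).
    by apply: (@continuous_comp _ _ _ fst); [exact: cvg_fst | exact: continuous_poly].
  by apply: (@continuousM _ _ snd); [exact: cvg_snd | exact: kc].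
- by rewrite mul0r addr0 horner_coef0 coefD coefMX coefC addr0.
- rewrite !hornerMXaddC /=.
  have -> : P.[a] = P.[b] + (a - b) * k (a, b) by rewrite -kE; ring.
  ring.
Qed.

(** Up to sign, the quotient of the first two coefficients is the sum of the
    inverses of the roots. *)
Lemma prod_XsubC_coef1_le (K : numDomainType) (rs : seq K) (r : K) :
    0 <= r -> (forall z, z \in rs -> r <= `|z|) ->
  `|(\prod_(z <- rs) ('X - z%:P))`_1| * r
    <= (size rs)%:R * `|(\prod_(z <- rs) ('X - z%:P))`_0|.
Proof.
move=> r0; elim: rs => [|z rs IH] rsr.
  by rewrite big_nil coefC /= normr0 mul0r mul0r.
rewrite big_cons mulrBl !coefB !coefXM !coefCM /= sub0r normrN.
set q0 := _`_0; set q1 := _`_1.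
have {}IH : `|q1| * r <= (size rs)%:R * `|q0|.
  by apply: IH => w wrs; apply: rsr; rewrite inE wrs orbT.
have rz : r <= `|z| by apply: rsr; rewrite inE eqxx.
apply: (le_trans (ler_wpM2r r0 (ler_normB _ _))).
rewrite mulrDl !normrM -natr1 mulrDl mul1r addrC lerD //.
  by rewrite -mulrA [leRHS]mulrCA ler_wpM2l.
by rewrite mulrC ler_wpM2r.
Qed.

(** If every root were larger than this, the coefficient of degree one would be too
    small by the previous lemma. *)
Lemma small_root (K : numClosedFieldType) (p : {poly K}) : p`_1 != 0 ->
  exists2 z, root p z & `|z| * `|p`_1| <= (2 * size p)%:R * `|p`_0|.
Proof.
move=> p1; apply: contrapT => nz.
have p_neq0 : p != 0 by apply: contraNneq p1 => ->; rewrite coef0.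
have sp : (0 < size p)%N by rewrite size_poly_gt0.
have P0 : 0 < `|p`_1| by rewrite normr_gt0.
have far z : root p z -> (2 * size p)%:R * `|p`_0| / `|p`_1| <= `|z|.
  move=> pz; rewrite ler_pdivrMr //; apply: ltW.
  rewrite real_ltNge ?realM ?normr_real ?realn //.
  by apply/negP => zp; apply: nz; exists z.
have [rs prs] := closed_field_poly_normal p.
have lp : lead_coef p != 0 by rewrite lead_coef_eq0.
have srs : (size rs < size p)%N.
  by rewrite prs size_scale // size_prod_XsubC.
set r := (2 * size p)%:R * `|p`_0| / `|p`_1| in far.
set q := \prod_(z <- rs) ('X - z%:P) in prs.
have qr : `|q`_1| * r <= (size rs)%:R * `|q`_0|.
  apply: prod_XsubC_coef1_le; first by rewrite divr_ge0 ?mulr_ge0.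
  by move=> z zrs; apply: far; rewrite prs rootZ // root_prod_XsubC.
have {qr} : (2 * size p)%:R * `|p`_0| <= (size rs)%:R * `|p`_0|.
  have -> : (2 * size p)%:R * `|p`_0| = `|p`_1| * r.
    by rewrite [RHS]mulrC /r divfK ?gt_eqF.
  have pE i : `|p`_i| = `|lead_coef p| * `|q`_i| by rewrite {1}prs coefZ normrM.
  by rewrite (pE 0%N) (pE 1%N) -mulrA [leRHS]mulrCA ler_wpM2l.
have [p0|p0] := eqVneq p`_0 0.
  have pz : root p 0 by rewrite rootE horner_coef0 p0.
  by move=> _; apply: nz; exists 0; rewrite // p0 !normr0 mul0r mulr0.
rewrite ler_pM2r ?normr_gt0 // ler_nat leqNgt => /negP; apply.
by apply: (leq_trans srs); rewrite leq_pmull.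
Qed.

Lemma linear_bound_continuous (K : numFieldType) (T : K -> K) (c : K) :
    T 0 = 0 -> (\forall y \near (0 : K), `|T y| <= c * `|y|) ->
  {for 0, continuous T}.
Proof.
move=> T0 Tle; apply/(cvgrPdist_lt (F := nbhs (0 : K))) => e e0; rewrite T0.
have d0 : 0 < e / (`|c| + 1) by rewrite divr_gt0 // ltr_wpDl.
have := near_ball (0 : K) _ d0; rewrite -ball_normE.
move: Tle; apply: filterS2 => y Ty; rewrite /ball_ /= !sub0r !normrN => yd.
apply: (le_lt_trans Ty).
have c0 : 0 <= `|c| by [].
have [->|y0] := eqVneq y 0; first by rewrite normr0 mulr0.
have cr : c \is Num.real.
  have : 0 <= c * `|y| by apply: le_trans Ty.
  by rewrite pmulr_lge0 ?normr_gt0 // => /ger0_real.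
apply: (@le_lt_trans _ _ ((`|c| + 1) * `|y|)).
  by rewrite ler_wpM2r // (le_trans (real_ler_norm cr)) // lerDl.
by rewrite mulrC -ltr_pdivlMr // ltr_wpDl.
Qed.

(** The fibre over [y] is the zero set of a polynomial whose constant coefficient is
    proportional to [y] and whose coefficient of degree one stays away from zero.
    A root of size [O(y)] exists because the field is algebraically closed;
    choosing one for each [y] gives a right inverse continuous at [0]. *)
Lemma rational_inverse (K : numClosedFieldType) (A Q : {poly K}) :
    A.[0] != 0 -> Q.[0] != 0 ->
  exists T : K -> K, [/\ T 0 = 0, holo_at T 0,
    \forall y \near (0 : K), T y * A.[T y] / Q.[T y] = y &
    \forall x \near (0 : K), T (x * A.[x] / Q.[x]) = x].
Proof.
move=> A0 Q00.
pose P := A * 'X.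
have PE x : P.[x] = x * A.[x] by rewrite hornerMX mulrC.
have P0 : P`_0 = 0 by rewrite coefMX.
have P1 : P`_1 != 0 by rewrite coefMX -horner_coef0.
have Q0 : Q`_0 != 0 by rewrite -horner_coef0.
suff [T [T0 hT TK KT]] : exists T : K -> K, [/\ T 0 = 0, holo_at T 0,
    \forall y \near (0 : K), P.[T y] / Q.[T y] = y &
    \forall x \near (0 : K), T (P.[x] / Q.[x]) = x].
  exists T; split => //.
    by move: TK; apply: filterS => y; rewrite PE.
  by move: KT; apply: filterS => y; rewrite PE.
pose p (y : K) := P - y *: Q.
have pE y i : (p y)`_i = P`_i - y * Q`_i by rewrite coefB coefZ.
pose n := (2 * maxn (size P) (size Q))%N.
have /choice[T TP] : forall y, exists z, (p y)`_1 != 0 ->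
    root (p y) z /\ `|z| * `|(p y)`_1| <= n%:R * `|(p y)`_0|.
  move=> y.
  have [y1|y1] := pselect ((p y)`_1 != 0); last by exists 0.
  have [z pz zle] := small_root y1; exists z => _; split=> //.
  apply: (le_trans zle); rewrite ler_wpM2r // ler_nat leq_mul2l /=.
  by apply: (leq_trans (size_polyD _ _)); rewrite size_polyN geq_max leq_maxl
    (leq_trans (size_scale_leq _ _)) ?leq_maxr.
have P10 : 0 < `|P`_1| by rewrite normr_gt0.
have near1 : \forall y \near (0 : K), `|P`_1| / 2 < `|(p y)`_1|.
  have : P`_1 - y * Q`_1 @[y --> (0 : K)] --> P`_1.
    apply: continuous_cvg_to; last by rewrite mul0r subr0.
    apply: holo_cont; apply: holoB; first exact: holo_cst.
    by apply: holoM; [exact: holo_id | exact: holo_cst].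
  move=> /cvgr_norm_gt.
  have lt1 : `|P`_1| / 2 < `|P`_1| by rewrite ltr_pdivrMr // ltr_pMr ?ltr1n.
  by move=> /(_ _ lt1); apply: filterS => y; rewrite pE.
have T0 : T 0 = 0.
  have [|_] := TP 0; first by rewrite pE mul0r subr0.
  rewrite !pE !mul0r !subr0 P0 normr0 mulr0 => T0le.
  apply/eqP; rewrite -normr_le0 -(ler_pM2r P10) mul0r //.
pose c := n%:R * `|Q`_0| / (`|P`_1| / 2).
have Tle : \forall y \near (0 : K), `|T y| <= c * `|y|.
  move: near1; apply: filterS => y y1.
  have y1gt0 : 0 < `|(p y)`_1| by rewrite (lt_trans _ y1) ?divr_gt0.
  have [|_] := TP y; first by rewrite -normr_gt0.
  rewrite [X in _ <= _ * `|X|]pE P0 sub0r normrN normrM => Tyle.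
  rewrite /c mulrAC ler_pdivlMr ?divr_gt0 //.
  apply: le_trans (ler_wpM2l (normr_ge0 _) (ltW y1)) _.
  by rewrite (le_trans Tyle) // mulrCA mulrC.
have Tc : {for 0, continuous T}.
  exact: linear_bound_continuous T0 Tle.
have rootT : \forall y \near (0 : K), P.[T y] = y * Q.[T y].
  move: near1; apply: filterS => y y1.
  have y1gt0 : 0 < `|(p y)`_1| by rewrite (lt_trans _ y1) ?divr_gt0.
  have [|+ _] := TP y; first by rewrite -normr_gt0.
  by rewrite rootE !hornerE subr_eq0 => /eqP.
have Qc := @continuous_poly _ Q.
have Pc := @continuous_poly _ P.
have QT0 : \forall y \near (0 : K), Q.[T y] != 0.
  apply: (near_neq0 (f := fun y => Q.[T y])); last by rewrite T0.
  by apply: (@continuous_comp _ _ _ T); [exact: Tc | exact: Qc].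
have TK : \forall y \near (0 : K), P.[T y] / Q.[T y] = y.
  by move: rootT QT0; apply: filterS2 => y -> Qy; rewrite mulfK.
have [kP [kPc kP0 kPE]] := poly_divided_difference P.
have [kQ [kQc kQ0 kQE]] := poly_divided_difference Q.
pose k (u : K * K) := (kP u * Q.[u.2] - P.[u.2] * kQ u) / (Q.[u.1] * Q.[u.2]).
have Q1c : continuous (fun u : K * K => Q.[u.1]).
  by move=> u; apply: (@continuous_comp _ _ _ fst); [exact: cvg_fst | exact: Qc].
have Q2c : continuous (fun u : K * K => Q.[u.2]).
  by move=> u; apply: (@continuous_comp _ _ _ snd); [exact: cvg_snd | exact: Qc].
have P2c : continuous (fun u : K * K => P.[u.2]).
  by move=> u; apply: (@continuous_comp _ _ _ snd); [exact: cvg_snd | exact: Pc].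
have QQ0 : \forall u \near ((0, 0) : K * K), Q.[u.1] * Q.[u.2] != 0.
  apply: (near_neq0 (f := fun u : K * K => Q.[u.1] * Q.[u.2])).
    by apply: (@continuousM _ _ (fun u => Q.[u.1])); [exact: Q1c | exact: Q2c].
  by rewrite mulf_neq0.
have [] := @inverse_holo K (fun x => P.[x] / Q.[x]) T k; last by exists T.
- by rewrite horner_coef0 P0 mul0r.
- apply: (@continuousM _ _ (fun x => P.[x])); first exact: Pc.
  by apply: (@continuousV _ _ (fun x => Q.[x])); last exact: Qc.
- exact: T0.
- exact: Tc.
- rewrite /k /= kP0 !horner_coef0 P0 mul0r subr0.
  by rewrite mulf_neq0 ?invr_eq0 ?mulf_neq0.
- move: QQ0; apply: filterS => u QQ.
  apply: (@continuousM _ _ (fun u => kP u * Q.[u.2] - P.[u.2] * kQ u)).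
    apply: (@continuousB _ _ _ (fun u => kP u * Q.[u.2])).
      by apply: (@continuousM _ _ kP); [exact: kPc | exact: Q2c].
    by apply: (@continuousM _ _ (fun u => P.[u.2])); [exact: P2c | exact: kQc].
  apply: (@continuousV _ _ (fun u => Q.[u.1] * Q.[u.2])) => //.
  by apply: (@continuousM _ _ (fun u => Q.[u.1])); [exact: Q1c | exact: Q2c].
- move: QQ0; apply: filterS => -[a b] /=; rewrite mulf_eq0 negb_or => /andP[Qa Qb].
  have -> : (a - b) * k (a, b) = ((a - b) * kP (a, b) * Q.[b]
      - P.[b] * ((a - b) * kQ (a, b))) / (Q.[a] * Q.[b]).
    by rewrite /k /=; ring.
  by rewrite -kPE -kQE; field; rewrite Qa Qb.
- exact: TK.
Qed.

(** * The plane quartic *)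

Section PlaneCurve.
Context {K : numFieldType}.
Implicit Types v w y z tau : K.

(** The part of the equation that involves the last two variables; it is weighted
    homogeneous of degree 9 for the weights 3, 2 and 1 of [a], [b] and [t]. *)
Definition plane_family (t a b : K) : K :=
  a ^+ 3 + a * b ^+ 3 + 432 * t ^+ 3 * (a + 4 * t * b) ^+ 2
  - 120 * t ^+ 2 * a * b ^+ 2 - 416 * t ^+ 3 * b ^+ 3 + 7 * t * b ^+ 4.

Lemma plane_family_scale (t a b : K) : t != 0 ->
  plane_family t a b = t ^+ 9 * plane_family 1 (a / t ^+ 3) (b / t ^+ 2).
Proof. by move=> t0; rewrite /plane_family; field. Qed.

(** The rational quartic [plane_family 1] is parametrized by
    [z = - s ^ 2 (s + 6) / (s + 3)], [v = - s ^ 6 / (s + 3) ^ 2], where [v] is the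
    value of [osculating_conic]. The singular point is at [s = 0], and its line
    [z = 0] meets the curve again at [s = -6]. Here [tau = s + 6] is the local
    parameter at that other point. *)
Definition param_z tau : K := (tau - 6) ^+ 2 * tau / (3 - tau).

Definition osculating_conic y z : K := 12 * (y + 4 * z) - z ^+ 2.

(** The factor of the equation that vanishes on the branch [s = tau - 6]; it is a unit
    at the singular point. *)
Definition simple_sheet v tau : K := v + (tau - 6) ^+ 6 / (3 - tau) ^+ 2.

(** Minus the mean of the two values of [v] over [param_z tau] that tend to [0]. *)
Definition centre tau : K :=
  tau ^+ 3 * (18 * tau + (tau - 6) ^+ 3) / (3 - tau) ^+ 2.

(** The discriminant of the two small values of [v] is [144 tau ^ 7 / (tau - 3) ^ 2]
    times minus this unit. *)
Definition branch_unit tau : K := (tau ^+ 2 - 15 * tau + 72) / (3 - tau).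

(** Once the far root is split off, the cubic in [v] becomes a quadratic, that is
    [X ^ 2 + tau ^ 7 k] up to squares with [k = branch_unit tau]. This equals
    [k ^ 8 ((X / k ^ 4) ^ 2 + (tau / k) ^ 7)], which trades a seventh root of [k] for
    rational functions. *)
Lemma plane_family_factor y tau : 3 - tau != 0 -> tau ^+ 2 - 15 * tau + 72 != 0 ->
  plane_family 1 y (param_z tau) =
  simple_sheet (osculating_conic y (param_z tau)) tau * branch_unit tau ^+ 8
    / (48 * (3 - tau) ^+ 2)
  * (((3 - tau) * (osculating_conic y (param_z tau) + centre tau)
        / (6 * branch_unit tau ^+ 4)) ^+ 2
     + (tau / branch_unit tau) ^+ 7).
Proof.
move=> d0 k0.
set z := param_z tau.
have -> : plane_family 1 y z =
  simple_sheet (osculating_conic y z) tau / 1728 *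
  ((osculating_conic y z + centre tau) ^+ 2
    + 36 * tau ^+ 7 * (tau ^+ 2 - 15 * tau + 72) / (3 - tau) ^+ 3).
  by rewrite /plane_family /simple_sheet /osculating_conic /centre /z /param_z; field.
move: (osculating_conic y z) => v; rewrite /branch_unit.
move: (simple_sheet v tau) (centre tau) => s c.
by field; rewrite k0 d0.
Qed.

(** With [w = y + 4 z] the equation reads [12 g = (6 v - w z) ^ 2 + v w ^ 2]. If [w] is
    not zero then [m = (6 v - w z) / w] satisfies [v = - m ^ 2]; the two derivatives
    force [m = 2 z] and [z = 32], where the first derivative does not vanish. *)
Lemma plane_family_singular y z :
  plane_family 1 y z = 0 ->
  3 * y ^+ 2 + z ^+ 3 + 864 * (y + 4 * z) - 120 * z ^+ 2 = 0 ->
  3 * y * z ^+ 2 + 3456 * (y + 4 * z) - 240 * y * z - 1248 * z ^+ 2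
    + 28 * z ^+ 3 = 0 ->
  y = 0 /\ z = 0.
Proof.
move=> G0 Gy0 Gz0.
pose w := y + 4 * z; pose v := osculating_conic y z.
have wE : 12 * w = v + z ^+ 2 by rewrite /w /v /osculating_conic; ring.
have yE : y = w - 4 * z by rewrite /w; ring.
have cE : (6 * v - w * z) ^+ 2 + v * w ^+ 2 = 0.
  by rewrite -(mulr0 12) -G0 /plane_family /w /v /osculating_conic; ring.
have wyE : (6 * v - w * z) * (72 - z) + 6 * w ^+ 2 + v * w = 0.
  by rewrite -(mulr0 6) -Gy0 /w /v /osculating_conic; ring.
have wzE : (6 * v - w * z) * (12 * z + w) + z * w ^+ 2 = 0.
  rewrite -[RHS](subrr 0) -[X in _ = X - _](mulr0 24) -[X in _ = _ - X](mulr0 6).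
  by rewrite -{1}Gy0 -Gz0 /w /v /osculating_conic; ring.
have [w0|w0] := eqVneq w 0.
  have vE : v = - z ^+ 2 by apply/eqP; rewrite -addr_eq0 -wE w0 mulr0.
  move: cE; rewrite w0 vE mul0r subr0 expr0n /= mulr0 addr0 => /eqP.
  rewrite expf_eq0 /= mulf_eq0 pnatr_eq0 /= oppr_eq0 expf_eq0 /= => /eqP z0.
  by rewrite yE w0 z0 mulr0 subrr.
exfalso.
pose m := (6 * v - w * z) / w.
have kE : 6 * v - w * z = m * w by rewrite /m divfK.
have cancel a : a * w = 0 -> a = 0.
  by move/eqP; rewrite mulf_eq0 (negPf w0) orbF => /eqP.
have vE : v = - m ^+ 2.
  apply/eqP; rewrite -addr_eq0; apply/eqP/cancel/cancel.
  by rewrite -cE kE; ring.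
have {}wyE : m * (72 - z) + 6 * w - m ^+ 2 = 0.
  by apply: cancel; rewrite -wyE kE vE; ring.
have {}wzE : m * (12 * z + w) + z * w = 0.
  by apply: cancel; rewrite -wzE kE; ring.
have sE : w * (m + z) = - 6 * m ^+ 2.
  by apply/eqP; rewrite -subr_eq0 -(subrr (m * w)) -{2}kE vE; apply/eqP; ring.
have m0 : m != 0.
  apply: contraNneq w0 => m0; move: wyE; rewrite m0 mul0r add0r expr0n subr0 => /eqP.
  by rewrite mulf_eq0 pnatr_eq0.
have mE : m = 2 * z.
  apply/eqP; rewrite eq_sym -subr_eq0 -(mulrI_eq0 _ (lregP m0)).
  rewrite -(mulrI_eq0 _ (lregP (_ : 6 != 0))) ?pnatr_eq0 //.
  rewrite -[X in _ == X]wzE -[X in _ == X]addr0; apply/eqP.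
  have -> : m * (12 * z + w) + z * w = 12 * m * z + w * (m + z) by ring.
  by rewrite sE; ring.
have z0 : z != 0 by apply: contraNneq m0 => z0; rewrite mE z0 mulr0.
have {}wE : 4 * w = - z ^+ 2.
  apply/eqP; rewrite -(inj_eq (mulfI (_ : 3 != 0))) ?pnatr_eq0 //; apply/eqP.
  have -> : 3 * (4 * w) = 12 * w by ring.
  by rewrite wE vE mE; ring.
have z32 : z = 32.
  apply/eqP; rewrite -subr_eq0 -(mulrI_eq0 _ (lregP z0)) -(mulrI_eq0 _ (lregP z0)).
  rewrite -(mulrI_eq0 _ (lregP (_ : 3 != 0))) ?pnatr_eq0 //; apply/eqP.
  have -> : 3 * (z * (z * (z - 32))) = - (3 * z * (- z ^+ 2)) - 96 * z ^+ 2 by ring.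
  rewrite -wE.
  have -> : - (3 * z * (4 * w)) = - 4 * (w * (2 * z + z)) by ring.
  by rewrite -mE sE mE; ring.
have : 2 * (m * (72 - z) + 6 * w - m ^+ 2) = 0 :> K by rewrite wyE mulr0.
have -> : 2 * (m * (72 - z) + 6 * w - m ^+ 2) =
    2 * m * (72 - z) + 3 * (4 * w) - 2 * m ^+ 2 by ring.
rewrite wE mE z32 => /eqP.
have -> : 2 * (2 * 32) * (72 - 32) + 3 * - 32 ^+ 2 - 2 * (2 * 32) ^+ 2 =
    - 6144%:R :> K by ring.
by rewrite oppr_eq0 pnatr_eq0.
Qed.
End PlaneCurve.

(** * Germs of hypersurfaces *)

Section Germs.
Context {R : realType} {n : nat}.
Local Notation C := (CC R).
Local Notation Cn := 'rV[C]_n.+1.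

(** Used to cut both sides of a local change of coordinates down to open sets that
    it exchanges. *)
Lemma open_setI_preimage (A B : set Cn) (phi : Cn -> Cn) :
    open A -> open B -> (forall x, A x -> differentiable phi x) ->
  open (A `&` phi @^-1` B).
Proof.
move=> Ao Bo dphi; rewrite openE => x [Ax Bx].
apply: filterI; first exact: open_nbhs_nbhs.
have : nbhs (phi x) B by exact: open_nbhs_nbhs.
exact: differentiable_continuous (dphi _ Ax) _.
Qed.

(** All conditions hold on the interiors of the sets where they are assumed; these
    interiors are then cut down to open sets that [phi] and [psi] exchange. *)
Lemma equivalent_germsI (f g : Cn -> C) (phi psi : Cn -> Cn) (u : Cn -> C) p q :
    phi p = q -> psi q = p -> holo_at phi p -> holo_at psi q ->
    (\forall x \near p, psi (phi x) = x) -> (\forall y \near q, phi (psi y) = y) ->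
    holo_at u p -> u p != 0 -> (\forall x \near p, f x = u x * g (phi x)) ->
  equivalent_germs f p g q.
Proof.
move=> phip psiq dphi dpsi psiK phiK du up fE.
pose P x := [/\ differentiable phi x, psi (phi x) = x, differentiable u x,
  u x != 0 & f x = u x * g (phi x)].
pose Q y := differentiable psi y /\ phi (psi y) = y.
have nP : \forall x \near p, P x.
  have un0 := near_neq0 (holo_cont du) up.
  have h1 : \forall x \near p, psi (phi x) = x /\ f x = u x * g (phi x).
    by move: psiK fE; apply: filterS2.
  have h2 : \forall x \near p, differentiable u x /\ u x != 0.
    by move: du un0; apply: filterS2.
  by move: dphi h1 h2; apply: filterS3 => x ? [? ?] [? ?].
have nQ : \forall y \near q, Q y.
  by move: dpsi phiK; apply: filterS2.
pose A := interior P; pose B := interior Q.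
have AP x : A x -> P x by apply: interior_subset.
have BQ y : B y -> Q y by apply: interior_subset.
have Ap : A p by exact: nP.
have Bq : B q by exact: nQ.
exists (A `&` phi @^-1` B), (B `&` psi @^-1` A), phi, psi, u.
have dA x : A x -> differentiable phi x by case/AP.
have dB y : B y -> differentiable psi y by case/BQ.
split; split.
- split; split.
  + exact: (open_setI_preimage (@open_interior _ P) (@open_interior _ Q) dA).
  + exact: (open_setI_preimage (@open_interior _ Q) (@open_interior _ P) dB).
  + by move=> x [/dA].
  + by move=> y [/dB].
  + move=> x [Ax Bx]; split; first exact: Bx.
    by have [_ e _ _ _] := AP x Ax; rewrite /preimage /mkset e.
  + move=> y [By Ay]; split; first exact: Ay.
    by have [_ e] := BQ y By; rewrite /preimage /mkset e.
  + by move=> x [/AP[]].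
  + by move=> y [/BQ[]].
- by split; [exact: Ap | rewrite /preimage /mkset phip; exact: Bq].
- exact: phip.
- by move=> x [/AP[]].
- by move=> x [/AP[]].
- by move=> x [/AP[]].
Qed.

End Germs.

(** * Coordinates and the singular locus *)

Section Coordinates.
Context {R : realType} {N : nat}.
Local Notation C := (CC R).
Local Notation CN1 := 'rV[C]_N.+1.
Implicit Types (x p : CN1).

Lemma holo_crd (i : nat) (p : CN1) : holo_at (fun x => crd x i) p.
Proof. exact: holo_coord. Qed.

Lemma crd0 (i : nat) : crd (0 : CN1) i = 0.
Proof. by rewrite /crd mxE. Qed.

Lemma crd_eq0 p : (forall i, (0 < i <= N.+1)%N -> crd p i = 0) -> p = 0.
Proof.
move=> p0; apply/rowP => j; rewrite mxE -(p0 j.+1 (ltn_ord j)) /crd /=.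
by congr (p _ _); rewrite inord_val.
Qed.

Definition axis (k : nat) : CN1 := delta_mx 0 (inord k.-1).

Lemma crd_axis s k i p : (0 < i <= N.+1)%N -> (0 < k <= N.+1)%N ->
  crd (s *: axis k + p) i = crd p i + (if i == k then s else 0).
Proof.
case: i k => [|i] [|k] //= iN kN; rewrite /crd !mxE eqxx /= addrC; congr (_ + _).
by rewrite -val_eqE /= !inordK // eqSS; case: eqP; rewrite ?mulr1 ?mulr0.
Qed.

Definition square_sum x : C := \sum_(1 <= i < N) crd x i ^+ 2.

Lemma square_sum_axis s k p : (0 < k < N)%N ->
  square_sum (s *: axis k + p) = square_sum p + s * (2 * crd p k + s).
Proof.
move=> kN.
have -> : square_sum (s *: axis k + p) = \sum_(1 <= i < N)
    (crd p i ^+ 2 + (if i == k then s * (2 * crd p i + s) else 0)).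
  apply: eq_big_nat => i /andP[i1 iN].
  rewrite crd_axis; [|lia|lia].
  by case: ifP => _; rewrite ?addr0 //; ring.
by rewrite big_split /= -big_mkcond big_nat1_eq kN.
Qed.

Lemma square_sum_axis_last s k p : (N <= k <= N.+1)%N -> (0 < k)%N ->
  square_sum (s *: axis k + p) = square_sum p.
Proof.
move=> /andP[Nk kN] k0; apply: eq_big_nat => i /andP[i1 iN].
rewrite crd_axis; [|lia|lia].
by rewrite (ltn_eqF (leq_trans iN Nk)) addr0.
Qed.

(** Common shape of the changes of coordinates: the first [N - 1] coordinates are
    scaled by one factor, the last two are replaced. *)
Definition replace_last (c a b : C) x : CN1 :=
  \row_j (if j == N.-1 :> nat then a else if j == N :> nat then b else x 0 j * c).

Lemma crd_replace_last c a b x (i : nat) : (0 < i < N)%N ->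
  crd (replace_last c a b x) i = crd x i * c.
Proof.
case: i => [//|i] /= iN; rewrite /crd mxE /= inordK; last by apply/ltnW/leqW.
rewrite !ltn_eqF ?(ltnW iN) //.
by rewrite -ltnS prednK // (leq_trans _ iN).
Qed.

Lemma crd_replace_lastN c a b x : crd (replace_last c a b x) N = a.
Proof. by rewrite /crd mxE inordK ?eqxx // ltnS leq_pred. Qed.

Lemma crd_replace_lastSN c a b x : (0 < N)%N ->
  crd (replace_last c a b x) N.+1 = b.
Proof.
by move=> N0; rewrite /crd mxE inordK ?eqxx //= gtn_eqF // prednK.
Qed.

Lemma replace_lastK c a b c' a' b' x : c * c' = 1 ->
  a' = crd x N -> b' = crd x N.+1 ->
  replace_last c' a' b' (replace_last c a b x) = x.
Proof.
move=> cc -> ->; apply/rowP => j; rewrite !mxE /crd /=.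
have jE (k : nat) : j = k :> nat -> inord k = j by move=> <-; rewrite inord_val.
case: eqP => [/jE -> //|_]; case: eqP => [/jE -> //|_].
by rewrite -mulrA cc mulr1.
Qed.

Lemma replace_last0 c : replace_last c 0 0 0 = 0.
Proof. by apply/rowP => j; rewrite !mxE mul0r !if_same. Qed.

Lemma holo_replace_last (c a b : CN1 -> C) p :
    holo_at c p -> holo_at a p -> holo_at b p ->
  holo_at (fun x => replace_last (c x) (a x) (b x) x) p.
Proof.
move=> hc ha hb; apply: holo_row => j.
case: (j == N.-1 :> nat); first exact: ha.
case: (j == N :> nat); first exact: hb.
apply: holoM; last exact: hc.
exact: holo_coord.
Qed.

End Coordinates.

Section VanishingDifferential.
Context {K : numFieldType} {V : normedModType K}.

(** Each partial derivative of a polynomial is read off from an exact first-order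
    expansion along a coordinate axis. *)
Lemma is_diff0_slice (f : V -> K) (p v : V) (q : K -> K) :
    is_diff p f 0 -> holo_at q 0 ->
    (forall s, f (s *: v + p) = f p + s * q s) ->
  q 0 = 0.
Proof.
move=> [df f0] hq fq.
have <- : 'D_v f p = q 0.
  rewrite /derive; apply: cvg_lim => //.
  have : q s @[s --> (0 : K)^'] --> q 0 by apply: cvg_within_filter; exact: holo_cont.
  apply: cvg_trans; apply: near_eq_cvg.
  have : \forall s \near (0 : K)^', s != 0 by exact: nbhs_dnbhs_neq.
  apply: filterS => s s0 /=.
  by rewrite fq addrC addKr; apply/esym; rewrite /GRing.scale /= mulKf.
by rewrite deriveE // f0.
Qed.

Lemma is_diffM0 (f g : V -> K) (p : V) :
    holo_at f p -> holo_at g p -> f p = 0 -> g p = 0 ->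
  is_diff p (fun x => f x * g x) 0.
Proof.
move=> /nbhs_singleton df /nbhs_singleton dg f0 g0.
have h := is_diffM (differentiableP df) (differentiableP dg).
by rewrite f0 g0 !scale0r addr0 in h.
Qed.

Lemma is_diffD0 (f g : V -> K) (p : V) :
  is_diff p f 0 -> is_diff p g 0 -> is_diff p (fun x => f x + g x) 0.
Proof. by move=> df dg; have h := is_diffD df dg; rewrite addr0 in h. Qed.

Lemma is_diff_sum0 (F : nat -> V -> K) (p : V) m k :
  (forall i, is_diff p (F i) 0) -> is_diff p (fun x => \sum_(m <= i < k) F i x) 0.
Proof.
move=> dF; rewrite /index_iota; elim: (iota _ _) => [|i s IH].
  have -> : (fun x => \sum_(i <- [::]) F i x) = cst 0.
    by apply/funext => x; rewrite big_nil.
  exact: is_diff_cst.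
have -> : (fun x => \sum_(j <- i :: s) F j x) =
    (fun x => F i x + \sum_(j <- s) F j x).
  by apply/funext => x; rewrite big_cons.
exact: is_diffD0.
Qed.
Lemma is_diff_squares_curve (t : K) (k : nat) (h : nat -> V -> K) (a b : V -> K)
    (p : V) :
    (forall i, holo_at (h i) p) -> (forall i, h i p = 0) ->
    holo_at a p -> holo_at b p -> a p = 0 -> b p = 0 ->
  is_diff p (fun x => \sum_(1 <= i < k) h i x ^+ 2 + plane_family t (a x) (b x)) 0.
Proof.
move=> hh h0 ha hb a0 b0; apply: is_diffD0.
  apply: is_diff_sum0 => i.
  have -> : (fun x => h i x ^+ 2) = (fun x => h i x * h i x).
    by apply/funext => x; rewrite expr2.
  exact: is_diffM0.
have -> : (fun x => plane_family t (a x) (b x)) = (fun x =>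
    a x * (a x ^+ 2 + b x ^+ 3 + 432 * t ^+ 3 * (a x + 8 * t * b x)
      - 120 * t ^+ 2 * b x ^+ 2)
    + b x * (6912 * t ^+ 5 * b x - 416 * t ^+ 3 * b x ^+ 2 + 7 * t * b x ^+ 3)).
  by apply/funext => x; rewrite /plane_family; ring.
apply: is_diffD0; apply: is_diffM0 => //.
- by holo.
- by rewrite a0 b0; ring.
- by holo.
- by rewrite b0; ring.
Qed.

End VanishingDifferential.

Section Singular.
Context {R : realType} {N : nat} (N0 : (0 < N)%N).
Local Notation C := (CC R).
Local Notation CN1 := 'rV[C]_N.+1.
Context (t : C).
Implicit Types (x p : CN1).

Lemma f_E x : f_ t x = square_sum x + plane_family t (crd x N) (crd x N.+1).
Proof. by rewrite /f_ /E7_form /plane_family -/(square_sum x); ring. Qed.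

Lemma crd_axisN s p : crd (s *: axis N + p) N = crd p N + s.
Proof. by rewrite crd_axis ?N0 ?leqnSn ?eqxx. Qed.

Lemma crd_axisNS s p : crd (s *: axis N + p) N.+1 = crd p N.+1.
Proof. by rewrite crd_axis ?N0 ?leqnSn ?leqnn // gtn_eqF // addr0. Qed.

Lemma crd_axisSN s p : crd (s *: axis N.+1 + p) N = crd p N.
Proof. by rewrite crd_axis ?N0 ?leqnSn ?leqnn // ltn_eqF // addr0. Qed.

Lemma crd_axisSNS s p : crd (s *: axis N.+1 + p) N.+1 = crd p N.+1 + s.
Proof. by rewrite crd_axis ?leqnn // eqxx. Qed.

Lemma singular_equations p : singular_points (f_ t) p ->
  let a := crd p N in let b := crd p N.+1 in
  [/\ forall k, (0 < k < N)%N -> crd p k = 0,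
      plane_family t a b = 0,
      3 * a ^+ 2 + b ^+ 3 + 864 * t ^+ 3 * (a + 4 * t * b)
        - 120 * t ^+ 2 * b ^+ 2 = 0 &
      3 * a * b ^+ 2 + 3456 * t ^+ 4 * (a + 4 * t * b) - 240 * t ^+ 2 * a * b
        - 1248 * t ^+ 3 * b ^+ 2 + 28 * t * b ^+ 3 = 0].
Proof.
move=> [fp0 dfp] a b.
have p0 k : (0 < k < N)%N -> crd p k = 0.
  move=> kN.
  have h : forall s, f_ t (s *: axis k + p) = f_ t p + s * (2 * crd p k + s).
    move=> s; rewrite !f_E square_sum_axis //.
    have [Nk NSk] : (N == k) = false /\ (N.+1 == k) = false by split; lia.
    by do 2![rewrite crd_axis; [|lia|lia]]; rewrite Nk NSk !addr0 addrAC.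
  have := is_diff0_slice dfp _ h; rewrite addr0 => /(_ _)/eqP.
  rewrite mulf_eq0 pnatr_eq0 /= => E; apply/eqP/E.
  by apply: holoD; [exact: holo_cst | exact: holo_id].
have sq0 : square_sum p = 0.
  by rewrite /square_sum big_nat_cond big1 // => i /andP[/p0 -> _]; rewrite expr0n.
split => //.
- by rewrite -fp0 f_E sq0 add0r.
- pose q s := (3 * a ^+ 2 + b ^+ 3 + 864 * t ^+ 3 * (a + 4 * t * b)
    - 120 * t ^+ 2 * b ^+ 2) + s * ((3 * a + 432 * t ^+ 3) + s).
  have h : forall s, f_ t (s *: axis N + p) = f_ t p + s * q s.
    move=> s; rewrite !f_E square_sum_axis_last ?leqnn ?leqnSn //.
    by rewrite crd_axisN crd_axisNS /plane_family /q -/a -/b; ring.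
  have := is_diff0_slice dfp _ h; rewrite {2}/q mul0r addr0; apply.
  apply: holoD; first exact: holo_cst.
  apply: holoM; first exact: holo_id.
  by apply: holoD; [exact: holo_cst | exact: holo_id].
- pose q s := (3 * a * b ^+ 2 + 3456 * t ^+ 4 * (a + 4 * t * b)
    - 240 * t ^+ 2 * a * b - 1248 * t ^+ 3 * b ^+ 2 + 28 * t * b ^+ 3)
    + s * ((3 * a * b + 6912 * t ^+ 5 - 120 * t ^+ 2 * a - 1248 * t ^+ 3 * b
            + 42 * t * b ^+ 2)
    + s * ((a - 416 * t ^+ 3 + 28 * t * b) + s * (7 * t))).
  have h : forall s, f_ t (s *: axis N.+1 + p) = f_ t p + s * q s.
    move=> s; rewrite !f_E square_sum_axis_last ?leqnn ?leqnSn //.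
    by rewrite crd_axisSN crd_axisSNS /plane_family /q -/a -/b; ring.
  have := is_diff0_slice dfp _ h; rewrite {2}/q mul0r addr0; apply.
  apply: holoD; first exact: holo_cst.
  apply: holoM; first exact: holo_id.
  apply: holoD; first exact: holo_cst.
  apply: holoM; first exact: holo_id.
  apply: holoD; first exact: holo_cst.
  by apply: holoM; [exact: holo_id | exact: holo_cst].
Qed.

Lemma singular_at0 : singular_points (f_ (N := N) t) 0.
Proof.
have sq0 : square_sum (0 : CN1) = 0.
  by rewrite /square_sum big1 // => i _; rewrite crd0 expr0n.
split; first by rewrite f_E sq0 !crd0 /plane_family; ring.
have -> : f_ t = fun x =>
    \sum_(1 <= i < N) crd x i ^+ 2 + plane_family t (crd x N) (crd x N.+1).
  by apply/funext => x; rewrite f_E.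
apply: is_diff_squares_curve.
- by move=> i; exact: holo_crd.
- by move=> i; exact: crd0.
- exact: holo_crd.
- exact: holo_crd.
- exact: crd0.
- exact: crd0.
Qed.

(** For nonzero [t] the equations of the plane factor are those of the quartic after
    rescaling [a] and [b] by their weights. *)
Lemma singular_points_f : singular_points (f_ (N := N) t) = [set 0].
Proof.
apply/seteqP; split => [p /singular_equations[p0]|_ ->]; last exact: singular_at0.
set a := crd p N; set b := crd p N.+1 => G0 Ga Gb.
suff [a0 b0] : a = 0 /\ b = 0.
  apply: crd_eq0 => i /andP[i0]; rewrite leq_eqVlt => /predU1P[-> //|].
  by rewrite ltnS leq_eqVlt => /predU1P[-> //|iN]; apply: p0; rewrite i0.
have [t0|t0] := eqVneq t 0.
  move: G0 Ga Gb; rewrite /plane_family t0 => G0 Ga Gb.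
  have ab : a * b = 0.
    apply/eqP; have : 3 * (a * b) * b == 0 by rewrite -Gb; apply/eqP; ring.
    by rewrite !mulf_eq0 pnatr_eq0 /= => /orP[//|->]; rewrite orbT.
  move/eqP: ab; rewrite mulf_eq0 => /orP[]/eqP E; move: Ga G0; rewrite E.
  - move=> Ga _; split => //; have : b ^+ 3 == 0 by rewrite -Ga; apply/eqP; ring.
    by rewrite expf_eq0 => /andP[_ /eqP].
  - move=> _ G0; split => //; have : a ^+ 3 == 0 by rewrite -G0; apply/eqP; ring.
    by rewrite expf_eq0 => /andP[_ /eqP].
have [] := @plane_family_singular _ (a / t ^+ 3) (b / t ^+ 2).
- apply/eqP; rewrite -(mulrI_eq0 _ (lregP (expf_neq0 9 t0))).
  by rewrite -plane_family_scale // G0.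
- by rewrite -[RHS](mul0r (t ^- 6)) -Ga; field.
- by rewrite -[RHS](mul0r (t ^- 7)) -Gb; field.
- move=> /eqP + /eqP; rewrite !mulf_eq0 !invr_eq0 !expf_eq0 /= (negPf t0) !orbF.
  by move=> /eqP ? /eqP.
Qed.
End Singular.

(** * The singularity of type A6 *)

Section Inverses.
Context {K : numClosedFieldType}.

Lemma param_z_inverse : exists T : K -> K, [/\ T 0 = 0, holo_at T 0,
  \forall z \near (0 : K), param_z (T z) = z &
  \forall tau \near (0 : K), T (param_z tau) = tau].
Proof.
have [||T [T0 hT TK KT]] :=
    @rational_inverse K (('X - 6%:P) ^+ 2) (3%:P - 'X).
- have -> : (('X - 6%:P) ^+ 2).[0] = 36%:R :> K by rewrite !hornerE; ring.
  by rewrite pnatr_eq0.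
- have -> : (3%:P - 'X).[0] = 3%:R :> K by rewrite !hornerE; ring.
  by rewrite pnatr_eq0.
have E (x : K) : x * (('X - 6%:P) ^+ 2).[x] / (3%:P - 'X).[x] = param_z x.
  by rewrite horner_exp hornerXsubC [x * _]mulrC !(hornerD, hornerN, hornerX, hornerC).
exists T; split => //.
  by move: TK; apply: filterS => z; rewrite E.
by move: KT; apply: filterS => z; rewrite E.
Qed.

Lemma div_branch_unit_inverse : exists T : K -> K, [/\ T 0 = 0, holo_at T 0,
  \forall b \near (0 : K), T b / branch_unit (T b) = b &
  \forall tau \near (0 : K), T (tau / branch_unit tau) = tau].
Proof.
have [||T [T0 hT TK KT]] :=
    @rational_inverse K (3%:P - 'X) ('X ^+ 2 - 15%:P * 'X + 72%:P).
- have -> : (3%:P - 'X).[0] = 3%:R :> K by rewrite !hornerE; ring.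
  by rewrite pnatr_eq0.
- have -> : ('X ^+ 2 - 15%:P * 'X + 72%:P).[0] = 72%:R :> K.
    rewrite !(hornerD, hornerN, hornerM, hornerXn, hornerX, hornerC).
    by rewrite expr0n mulr0 subr0 add0r.
  by rewrite pnatr_eq0.
have E (x : K) : x * (3%:P - 'X).[x] / ('X ^+ 2 - 15%:P * 'X + 72%:P).[x] =
    x / branch_unit x.
  rewrite !(hornerD, hornerN, hornerM, hornerXn, hornerX, hornerC).
  by rewrite /branch_unit invf_div mulrA.
exists T; split => //.
  by move: TK; apply: filterS => z; rewrite E.
by move: KT; apply: filterS => z; rewrite E.
Qed.

(** The substitution [r = sqrtC w0 * (1 + s)] turns the equation into
    [s (s + 2) = w / w0 - 1], solvable near [s = 0]. *)
Lemma square_root (w0 : K) : w0 != 0 -> exists r : K -> K,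
  [/\ r w0 != 0, holo_at r w0 & \forall w \near w0, r w ^+ 2 = w].
Proof.
move=> w00.
have [||S [S0 hS SK _]] := @rational_inverse K ('X + 2%:P) 1.
- have -> : ('X + 2%:P).[0] = 2%:R :> K by rewrite !hornerE; ring.
  by rewrite pnatr_eq0.
- by rewrite hornerC oner_eq0.
have hw : holo_at (fun w : K => w / w0 - 1) w0 by holo.
have w1 : w0 / w0 - 1 = 0 by rewrite divff // subrr.
exists (fun w => sqrtC w0 * (1 + S (w / w0 - 1))); split.
- by rewrite w1 S0 addr0 mulr1 sqrtC_eq0.
- have hSw : holo_at (fun w : K => S (w / w0 - 1)) w0.
    by apply: (holo_comp (g := S) hw); rewrite w1.
  by holo.
- have SK' : \forall y \near (0 : K), S y * (S y + 2) = y.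
    move: SK; apply: filterS => y.
    by rewrite hornerD hornerX !hornerC divr1.
  have : \forall w \near w0, S (w / w0 - 1) * (S (w / w0 - 1) + 2) = w / w0 - 1.
    exact: near_comp (holo_cont hw) w1 SK'.
  apply: filterS => w; set s := S _ => sE.
  rewrite exprMn sqrtCK.
  have -> : (1 + s) ^+ 2 = 1 + s * (s + 2) by ring.
  by rewrite sE addrC subrK mulrC divfK.
Qed.

(** The new coordinates are explicit except for two one-variable inverses, [tau] as a
    function of the second old variable and as a function of the second new one.
    The unit factor is given as a square because its root is what rescales the other
    variables. *)
Lemma plane_normal_form (t : K) : t != 0 ->
  exists (Phi Psi : K * K -> K * K) (r : K * K -> K),
  [/\ Phi (0, 0) = (0, 0), Psi (0, 0) = (0, 0) & r (0, 0) != 0] /\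
  [/\ holo_at Phi (0, 0), holo_at Psi (0, 0) & holo_at r (0, 0)] /\
  [/\ \forall u \near ((0, 0) : K * K), Psi (Phi u) = u,
      \forall w \near ((0, 0) : K * K), Phi (Psi w) = w &
      \forall u \near ((0, 0) : K * K),
        plane_family t u.1 u.2 = r u ^+ 2 * ((Phi u).1 ^+ 2 + (Phi u).2 ^+ 7)].
Proof.
move=> t0.
have [T [T0 hT TK KT]] := param_z_inverse.
have [Th [Th0 hTh ThK KTh]] := div_branch_unit_inverse.
pose o : K * K := (0, 0).
have h1 : holo_at (fun u : K * K => u.1) o by exact: holo_fst.
have h2 : holo_at (fun u : K * K => u.2) o by exact: holo_snd.
have n3 : (3 : K) != 0 by rewrite pnatr_eq0.
have n72 : (72 : K) != 0 by rewrite pnatr_eq0.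
have n6 : (6 : K) != 0 by rewrite pnatr_eq0.
have n48 : (48 : K) != 0 by rewrite pnatr_eq0.
have hd : holo_at (fun tau : K => 3 - tau) 0 by holo.
have d0 : 3 - 0 != 0 :> K by rewrite subr0.
have hk : holo_at (fun tau : K => tau ^+ 2 - 15 * tau + 72) 0 by holo.
have k0 : 0 ^+ 2 - 15 * 0 + 72 != 0 :> K by rewrite expr0n mulr0 subr0 add0r.
have hunit : holo_at (@branch_unit K) 0 by rewrite /branch_unit; holo.
have branch_unit0 : branch_unit (0 : K) != 0 by rewrite mulf_neq0 // invr_neq0.
have hcentre : holo_at (@centre K) 0.
  by rewrite /centre; holo; rewrite expf_neq0.
have centre0 : centre (0 : K) = 0 by rewrite /centre expr0n !mul0r.
have hz : holo_at (@param_z K) 0 by rewrite /param_z; holo.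
have z0 : param_z (0 : K) = 0 by rewrite /param_z mulr0 mul0r.
have nd : \forall tau \near (0 : K), 3 - tau != 0.
  exact: near_neq0 (holo_cont hd) d0.
have nk : \forall tau \near (0 : K), tau ^+ 2 - 15 * tau + 72 != 0.
  exact: near_neq0 (holo_cont hk) k0.
pose tau (u : K * K) := T (u.2 / t ^+ 2).
pose v (u : K * K) := osculating_conic (u.1 / t ^+ 3) (u.2 / t ^+ 2).
have htau : holo_at tau o.
  have h : holo_at (fun u : K * K => u.2 / t ^+ 2) o by holo.
  by apply: (holo_comp (g := T) h); rewrite /= mul0r.
have tau0 : tau o = 0 by rewrite /tau /= mul0r T0.
have hv : holo_at v o by rewrite /v /osculating_conic; holo.
have v0 : v o = 0 by rewrite /v /osculating_conic /= !mul0r; ring.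
(* In terms of (v, tau), the first new coordinate is A and the unit factor is W. *)
pose A (w : K * K) := (3 - w.2) * (w.1 + centre w.2) / (6 * branch_unit w.2 ^+ 4).
pose W (w : K * K) := t ^+ 9 *
  (simple_sheet w.1 w.2 * branch_unit w.2 ^+ 8 / (48 * (3 - w.2) ^+ 2)).
have hvt : holo_at (fun u => (v u, tau u)) o by exact: holo_pair.
have vt0 : (v o, tau o) = o by rewrite v0 tau0.
have hr2 : holo_at (fun w : K * K => branch_unit w.2) o by exact: holo_comp h2 hunit.
have hc2 : holo_at (fun w : K * K => centre w.2) o by exact: holo_comp h2 hcentre.
have hz2 : holo_at (fun w : K * K => param_z w.2) o by exact: holo_comp h2 hz.
have hA : holo_at A o by rewrite /A; holo; rewrite mulf_neq0 // expf_neq0.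
have A0 : A o = 0 by rewrite /A /= centre0 addr0 mulr0 mul0r.
have hW : holo_at W o.
  by rewrite /W /simple_sheet; holo; rewrite ?mulf_neq0 ?expf_neq0.
have W0 : W o != 0.
  rewrite /W /simple_sheet /= add0r sub0r !mulf_neq0 ?invr_neq0 ?mulf_neq0 //;
    by rewrite ?expf_neq0 ?oppr_eq0.
have [rt [rt0 hrt rtK]] := square_root W0.
pose Phi (u : K * K) := (A (v u, tau u), tau u / branch_unit (tau u)).
(* B recovers v from the first new coordinate, E recovers the two old ones. *)
pose B (w : K * K) := 6 * branch_unit w.2 ^+ 4 * w.1 / (3 - w.2) - centre w.2.
pose E (w : K * K) :=
  (t ^+ 3 * ((w.1 + param_z w.2 ^+ 2) / 12 - 4 * param_z w.2), t ^+ 2 * param_z w.2).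
pose Psi (w : K * K) := E (B (w.1, Th w.2), Th w.2).
have hPhi : holo_at Phi o.
  apply: holo_pair.
    by apply: (holo_comp (g := A) hvt); rewrite vt0.
  have hrt' : holo_at (fun u => branch_unit (tau u)) o.
    by apply: (holo_comp (g := @branch_unit K) htau); rewrite tau0.
  by holo; rewrite tau0.
have hTh2 : holo_at (fun w : K * K => Th w.2) o by exact: holo_comp h2 hTh.
have hB : holo_at B o by rewrite /B; holo.
have hwt : holo_at (fun w : K * K => (w.1, Th w.2)) o by exact: holo_pair.
have wt0 : (o.1, Th o.2) = o by rewrite /= Th0.
have B0 : B o = 0 by rewrite /B /= centre0 mulr0 mul0r subrr.
have hE : holo_at E o by apply: holo_pair; holo.
have hBT : holo_at (fun w : K * K => (B (w.1, Th w.2), Th w.2)) o.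
  apply: holo_pair => //.
  by apply: (holo_comp (g := B) hwt); rewrite wt0.
have BT0 : (B (o.1, Th o.2), Th o.2) = o by rewrite /= Th0 B0.
have hPsi : holo_at Psi o.
  by apply: (holo_comp (g := E) hBT); rewrite BT0.
have hWvt : holo_at (fun u => W (v u, tau u)) o.
  by apply: (holo_comp (g := W) hvt); rewrite vt0.
have Wvt0 : W (v o, tau o) = W o by rewrite vt0.
have htau2 : {for o, continuous tau} by exact: holo_cont.
have hz2t : holo_at (fun u : K * K => u.2 / t ^+ 2) o by holo.
have hTh2c : {for o, continuous (fun w : K * K => Th w.2)} by exact: holo_cont.
have nTK : \forall u \near o, param_z (tau u) = u.2 / t ^+ 2.
  by apply: (near_comp (holo_cont hz2t) _ TK); rewrite /= mul0r.
have nKTh : \forall u \near o, Th (tau u / branch_unit (tau u)) = tau u.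
  exact: near_comp htau2 tau0 KTh.
have nd1 : \forall u \near o, 3 - tau u != 0 by exact: near_comp htau2 tau0 nd.
have nk1 : \forall u \near o, tau u ^+ 2 - 15 * tau u + 72 != 0.
  exact: near_comp htau2 tau0 nk.
have nThK : \forall w \near o, Th w.2 / branch_unit (Th w.2) = w.2.
  by apply: (near_comp (f := fun w : K * K => w.2) (holo_cont h2) _ ThK).
have nKT : \forall w \near o, T (param_z (Th w.2)) = Th w.2.
  exact: (near_comp (f := fun w : K * K => Th w.2) hTh2c Th0 KT).
have nd2 : \forall w \near o, 3 - Th w.2 != 0.
  exact: (near_comp (f := fun w : K * K => Th w.2) hTh2c Th0 nd).
have nk2 : \forall w \near o, Th w.2 ^+ 2 - 15 * Th w.2 + 72 != 0.
  exact: (near_comp (f := fun w : K * K => Th w.2) hTh2c Th0 nk).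
have nrt : \forall u \near o, rt (W (v u, tau u)) ^+ 2 = W (v u, tau u).
  exact: (near_comp (f := fun u => W (v u, tau u)) (holo_cont hWvt) Wvt0 rtK).
have branch_unit_neq0 s :
    3 - s != 0 -> s ^+ 2 - 15 * s + 72 != 0 -> branch_unit s != 0 :> K.
  by move=> ds ks; rewrite mulf_neq0 // invr_neq0.
exists Phi, Psi, (fun u => rt (W (v u, tau u))); split; [|split]; split.
- by rewrite /Phi vt0 A0 tau0 mul0r.
- rewrite /Psi BT0 /E /= z0.
  by congr (_, _); ring.
- by rewrite vt0.
- exact: hPhi.
- exact: hPsi.
- by apply: (holo_comp (g := rt) hWvt); rewrite vt0.
- have : \forall u \near o, 3 - tau u != 0 /\ tau u ^+ 2 - 15 * tau u + 72 != 0.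
    by move: nd1 nk1; apply: filterS2.
  move: nTK nKTh; apply: filterS3 => u uz uTh [ud uk].
  have ur := branch_unit_neq0 _ ud uk.
  rewrite /Psi /Phi /= uTh /E /= uz.
  have -> : B (A (v u, tau u), tau u) = v u.
    rewrite /B /A /=; move: (branch_unit _) (centre _) ur => k c kn.
    by field; rewrite kn ud.
  rewrite [RHS]surjective_pairing; congr (_, _).
    by rewrite /v /osculating_conic; field.
  by field.
- have : \forall w \near o, 3 - Th w.2 != 0 /\ Th w.2 ^+ 2 - 15 * Th w.2 + 72 != 0.
    by move: nd2 nk2; apply: filterS2.
  move: nThK nKT; apply: filterS3 => w wTh wz [wd wk].
  have wr := branch_unit_neq0 _ wd wk.
  have tauE : tau (Psi w) = Th w.2.
    by rewrite /tau /Psi /E /= mulrC mulKf ?expf_neq0.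
  have vE : v (Psi w) = B (w.1, Th w.2).
    rewrite /v /Psi /E /=; move: (B _) (param_z _) => b z.
    by rewrite /osculating_conic; field.
  rewrite /Phi tauE vE wTh [RHS]surjective_pairing; congr (_, _).
  rewrite /A /B /=; move: (branch_unit _) (centre _) wr => k c kn.
  by field; rewrite kn wd.
- have : \forall u \near o, 3 - tau u != 0 /\ tau u ^+ 2 - 15 * tau u + 72 != 0.
    by move: nd1 nk1; apply: filterS2.
  move: nTK nrt; apply: filterS3 => u uz -> [ud uk].
  rewrite plane_family_scale //.
  rewrite -uz plane_family_factor // uz -/(v u).
  by rewrite /W /Phi /A /= !mulrA.
Qed.
End Inverses.

(** The unit [r ^ 2] of the plane normal form is taken out of the remaining squares as
    well, by dividing each of their variables by [r]. *)
Lemma equivalent_germs_A6 (R : realType) (N : nat) (t : CC R) : (0 < N)%N -> t != 0 ->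
  equivalent_germs (f_ (N := N) t) 0 (A_form 6) 0.
Proof.
move=> N0 t0.
have [Phi [Psi [r [[Phi0 Psi0 r0] [[hPhi hPsi hr] [PsiK PhiK fE]]]]]] :=
  plane_normal_form t0.
pose last_two (x : 'rV[CC R]_N.+1) := (crd x N, crd x N.+1).
have hl : holo_at last_two 0 by apply: holo_pair; exact: holo_crd.
have l0 : last_two 0 = (0, 0) by rewrite /last_two !crd0.
pose phi x :=
  replace_last (r (last_two x))^-1 (Phi (last_two x)).1 (Phi (last_two x)).2 x.
pose psi x :=
  replace_last (r (Psi (last_two x))) (Psi (last_two x)).1 (Psi (last_two x)).2 x.
have last_two_replace c a b x : last_two (replace_last c a b x) = (a, b).
  by rewrite /last_two crd_replace_lastN crd_replace_lastSN.
have hPhil : holo_at (fun x => Phi (last_two x)) 0.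
  by apply: (holo_comp (g := Phi) hl); rewrite l0.
have hPsil : holo_at (fun x => Psi (last_two x)) 0.
  by apply: (holo_comp (g := Psi) hl); rewrite l0.
have hrl : holo_at (fun x => r (last_two x)) 0.
  by apply: (holo_comp (g := r) hl); rewrite l0.
have hrPsil : holo_at (fun x => r (Psi (last_two x))) 0.
  by apply: (holo_comp (g := r) hPsil); rewrite l0 Psi0.
have hrV : holo_at (fun x => (r (last_two x))^-1) 0.
  by apply: holoV => //; rewrite l0.
have nr : \forall x \near (0 : 'rV[CC R]_N.+1), r (last_two x) != 0.
  by apply: near_neq0; [exact: holo_cont | rewrite l0].
have nrPsi : \forall x \near (0 : 'rV[CC R]_N.+1), r (Psi (last_two x)) != 0.
  apply: (near_neq0 (f := fun x => r (Psi (last_two x)))); first exact: holo_cont.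
  by rewrite l0 Psi0.
apply: (@equivalent_germsI _ _ _ _ phi psi (fun x => r (last_two x) ^+ 2)).
- by rewrite /phi l0 Phi0 replace_last0.
- by rewrite /psi l0 Psi0 replace_last0.
- apply: holo_replace_last => //.
    by apply: (holo_comp (g := fst) hPhil); exact: holo_fst.
  by apply: (holo_comp (g := snd) hPhil); exact: holo_snd.
- apply: holo_replace_last => //.
    by apply: (holo_comp (g := fst) hPsil); exact: holo_fst.
  by apply: (holo_comp (g := snd) hPsil); exact: holo_snd.
- have := near_comp (holo_cont hl) l0 PsiK.
  move: nr; apply: filterS2 => x rx PsiPhi.
  rewrite /psi {1 2 3}/phi last_two_replace -surjective_pairing PsiPhi.
  by apply: replace_lastK => //; rewrite mulVf.
- have := near_comp (holo_cont hl) l0 PhiK.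
  move: nrPsi; apply: filterS2 => x rx PhiPsi.
  rewrite /phi {1 2 3}/psi last_two_replace -surjective_pairing PhiPsi.
  by apply: replace_lastK => //; rewrite mulfV.
- exact: holoX.
- by rewrite l0 expf_neq0.
- have := near_comp (holo_cont hl) l0 fE.
  move: nr; apply: filterS2 => x rx /= curveE.
  rewrite f_E // curveE /A_form big_nat_recr //= {2 3}/phi.
  rewrite crd_replace_lastN crd_replace_lastSN // -addrA [RHS]mulrDr; congr (_ + _).
  rewrite big_distrr /=; apply: eq_big_nat => i iN.
  by rewrite /phi crd_replace_last // exprMn exprVn mulrCA divff ?mulr1 // expf_neq0.
Qed.

Theorem mainTheorem9 (R : realType) (N : nat) (hN : (1 <= N)%N) :
  type_E7 (f_ (R := R) (N := N) 0) 0 /\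
  generic (fun t : CC R =>
    singular_points (f_ (N := N) t) = [set 0] /\ type_A 6 (f_ (N := N) t) 0).
Proof.
have iso (t : CC R) : isolated_singularity (f_ (N := N) t) 0.
  rewrite /isolated_singularity singular_points_f //; split; first exact/mem_set.
  by exists setT; [exact: filterT | rewrite setTI].
split.
  split; first exact: iso.
  apply: (@equivalent_germsI _ _ _ _ id id (fun=> 1)) => //.
  - exact: holo_id.
  - exact: holo_id.
  - exact: near_everywhere.
  - exact: near_everywhere.
  - exact: holo_cst.
  - exact: oner_neq0.
  - by apply: near_everywhere => x; rewrite /f_ /=; ring.
apply: (sub_finite_set _ (finite_set1 (0 : CC R))) => t nt /=.
apply: contrapT => /eqP t0; apply: nt; split; first exact: singular_points_f.
by split; [exact: iso | exact: equivalent_germs_A6].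
Qed.
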